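(* Let $n\ge1$ and let $F_{3^{n-1},3}$ be the firecracker graph obtained from $3^{n-1}$ copies of the 3-vertex star (a center with two leaves) by joining one chosen leaf of each consecutive copy by an edge, forming a path through these chosen leaves. Then \[WL(Q_n^3, F_{3^{n-1},3})=2\big(3^{n-1}\big)\Big(\big(3^{n-1}-1\big)+\big( 2n-1\big)+n\Big).\]
   Context: $Q_n^3$ is the graph on $\{0,1,2\}^n$ in which two tuples are adjacent iff they differ in exactly one coordinate $j$ and there $x_j\equiv y_j\pm1\pmod 3$. For a bijection $f:V(G)\to V(T)$ into a tree $T$, $WL_f(G,T)$ is the sum over edges $(u,v)$ of $G$ of the distance in $T$ between $f(u)$ and $f(v)$, and $WL(G,T)=\min_f WL_f(G,T)$. *)

(* Defs.v *)
From mathcomp Require Import all_boot.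

Set Implicit Arguments.
Unset Strict Implicit.
Unset Printing Implicit Defensive.

Record sgraph := SGraph {
  svertex :> finType;
  adj : rel svertex;
  adj_sym : symmetric adj;
  adj_irrefl : irreflexive adj }.

Definition has_walk (G : sgraph) (x y : G) (k : nat) : bool :=
  [exists p : k.-tuple G, path (@adj G) x p && (last x p == y)].

(* The least k < #|G| such that a walk of length k joins x to y; the junk value
   #|G| is taken only when x and y are not connected (see gdistP). *)
Definition gdist (G : sgraph) (x y : G) : nat :=
  find (has_walk x y) (iota 0 #|G|).

Definition bij (G T : sgraph) (f : {ffun G -> T}) : bool :=
  injectiveb f && [forall t : T, exists x : G, f x == t].

(* The condition on enum_rank selects one orientation of each edge, so that the
   sum ranges over unordered edges. *)
Definition WLf (G T : sgraph) (f : {ffun G -> T}) : nat :=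
  \sum_(u : G) \sum_(v : G | adj u v && (enum_rank u < enum_rank v))
    gdist (f u) (f v).

(* The minimum of WLf over all bijections; the pick only supplies the witness
   required by arg min, and the junk value 0 is taken only when no bijection
   exists (see WLP). *)
Definition WL (G T : sgraph) : nat :=
  if [pick f : {ffun G -> T} | bij f] is Some f0
  then WLf [arg min_(f < f0 | bij f) WLf f] else 0.

Definition Q3_adj (n : nat) (x y : {ffun 'I_n -> 'I_3}) : bool :=
  [exists j : 'I_n,
    [&& x j != y j,
        [forall i : 'I_n, (i != j) ==> (x i == y i)] &
        (x j == y j + 1 %[mod 3]) || (x j + 1 == y j %[mod 3])]].

Lemma Q3_adj_sym (n : nat) : symmetric (@Q3_adj n).
Proof.
move=> x y; apply: eq_existsb => j; rewrite eq_sym; congr [&& _, _ & _].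
  by apply: eq_forallb => i; rewrite [x i == _]eq_sym.
by rewrite orbC eq_sym [X in _ || X]eq_sym.
Qed.

Lemma Q3_adj_irrefl (n : nat) : irreflexive (@Q3_adj n).
Proof. by move=> x; apply/existsP => -[j]; rewrite eqxx. Qed.

Definition Q3 (n : nat) : sgraph :=
  SGraph (@Q3_adj_sym n) (@Q3_adj_irrefl n).

(* F_{m,k}: m copies of the star on k vertices. The vertex (i, a) is the vertex
   number a of copy i, where 0 is the center, 1, ..., k-1 are the leaves and 1
   is the leaf chosen for the path. *)
Definition firecracker_adj (m k : nat) (x y : 'I_m * 'I_k) : bool :=
  ((x.1 == y.1) && ((x.2 == 0 :> nat) != (y.2 == 0 :> nat)))
  || [&& x.2 == 1 :> nat, y.2 == 1 :> nat &
         (x.1.+1 == y.1 :> nat) || (y.1.+1 == x.1 :> nat)].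

Lemma firecracker_adj_sym (m k : nat) : symmetric (@firecracker_adj m k).
Proof.
move=> x y; rewrite /firecracker_adj [x.1 == _]eq_sym andbCA.
congr (_ && ~~ _ || [&& _, _ & _]); [exact: eq_sym | exact: orbC].
Qed.

Lemma firecracker_adj_irrefl (m k : nat) : irreflexive (@firecracker_adj m k).
Proof.
by move=> x; rewrite /firecracker_adj !eqxx /= orbb (gtn_eqF (ltnSn _)) !andbF.
Qed.

Definition firecracker (m k : nat) : sgraph :=
  SGraph (@firecracker_adj_sym m k) (@firecracker_adj_irrefl m k).

Lemma has_walkP (G : sgraph) (x y : G) (k : nat) :
  reflect (exists p : seq G, [/\ size p = k, path (@adj G) x p & last x p = y])
          (has_walk x y k).
Proof.
apply: (iffP existsP) => [[p /andP[pp /eqP lp]]|[p [sp pp lp]]].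
  by exists p; rewrite size_tuple.
have spk : size p == k by apply/eqP.
by exists (Tuple spk); rewrite /= pp lp eqxx.
Qed.

Lemma gdistP (G : sgraph) (x y : G) : connect (@adj G) x y ->
  has_walk x y (gdist x y) /\ (forall k, has_walk x y k -> gdist x y <= k).
Proof.
move=> /connectP[p0 pp0 ->]; case/shortenP: pp0 => p pp up _.
have lt : size p < #|G| by have := max_card (mem (x :: p)); rewrite (card_uniqP up).
set y' := last x p.
have hw : has_walk x y' (size p) by apply/has_walkP; exists p.
have hh : has (has_walk x y') (iota 0 #|G|).
  by apply/hasP; exists (size p); rewrite ?mem_iota.
have dlt : gdist x y' < #|G| by move: hh; rewrite has_find size_iota.
split; first by have := nth_find 0 hh; rewrite nth_iota.
move=> k hk; rewrite leqNgt; apply/negP => kd.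
have := before_find 0 kd; rewrite nth_iota ?(ltn_trans kd dlt) //.
by rewrite add0n hk.
Qed.

Lemma bijP (G T : sgraph) (f : {ffun G -> T}) : reflect (bijective f) (bij f).
Proof.
apply: (iffP andP) => [[/injectiveP fi /forallP fs]|fb].
  apply: (inj_card_bij fi); rewrite -(card_codom fi); apply: subset_leq_card.
  by apply/subsetP => t _; have /existsP[x /eqP <-] := fs t; apply: codom_f.
split; first by apply/injectiveP; apply: bij_inj.
case: fb => g _ gK; apply/forallP => t.
by apply/existsP; exists (g t); rewrite gK.
Qed.

Lemma WLP (G T : sgraph) : (exists f : {ffun G -> T}, bijective f) ->
  (exists2 f : {ffun G -> T}, bijective f & WLf f = WL G T) /\
  (forall f : {ffun G -> T}, bijective f -> WL G T <= WLf f).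
Proof.
case=> f /bijP fb; rewrite /WL; case: pickP => [f0 f0b|/(_ f)]; last by rewrite fb.
case: arg_minnP => // g gb gmin; split; first by exists g => //; apply/bijP.
by move=> h /bijP; apply: gmin.
Qed.

Lemma firecracker_connected (m k : nat) (x y : firecracker m k) :
  1 < k -> connect (@adj (firecracker m k)) x y.
Proof.
move=> k1; have k0 : 0 < k by apply: ltnW.
have cs : connect_sym (@adj (firecracker m k)).
  by apply: sym_connect_sym; apply: adj_sym.
pose c i : firecracker m k := (i, Ordinal k0).
pose l i : firecracker m k := (i, Ordinal k1).
have cl i : connect (@adj (firecracker m k)) (c i) (l i).
  by apply: connect1; rewrite /= /firecracker_adj /= eqxx.
have toc u : connect (@adj (firecracker m k)) u (c u.1).
  case: u => i a; have [a0|a0] := eqVneq (a : nat) 0.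
    by rewrite (_ : a = Ordinal k0) //; apply: val_inj.
  by apply: connect1; rewrite /= /firecracker_adj /= eqxx (negPf a0).
have m0 : 0 < m by apply: leq_ltn_trans (ltn_ord x.1).
have ll d (h : d < m) :
    connect (@adj (firecracker m k)) (l (Ordinal m0)) (l (Ordinal h)).
  elim: d h => [|d IH] h.
    by rewrite (_ : Ordinal m0 = Ordinal h) //; apply: val_inj.
  apply: connect_trans (IH (ltnW h)) _; apply: connect1.
  by rewrite /= /firecracker_adj /= eqxx orbT.
have tox u : connect (@adj (firecracker m k)) (l (Ordinal m0)) u.
  apply: (@connect_trans _ _ (l u.1)).
    by rewrite (_ : u.1 = Ordinal (ltn_ord u.1)); [apply: ll | apply: val_inj].
  by rewrite cs; apply: connect_trans (toc u) (cl _).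
by apply: connect_trans (tox y); rewrite cs.
Qed.

(* Main.v *)
Require Import Defs.
From mathcomp Require Import all_boot.
From mathcomp Require Import zify.

Set Implicit Arguments.
Unset Strict Implicit.
Unset Printing Implicit Defensive.

(* Give each firecracker vertex the position i of its copy on the path and its
   height h (0, 1 or 2) above the path. The distance of two vertices is
   |i - i'| + h + h', except for the two vertices of positive height in one
   copy, where it is smaller by 2. Since Q_n^3 is 2n-regular, the heights
   contribute the same amount to every embedding, and the correction is largest
   when each such pair of vertices is adjacent in Q_n^3. The sum of |i - i'|
   counts, over the edges of the path, the boundary of a set of 3t vertices of
   Q_n^3, which is bounded by Lindsey's edge-isoperimetric theorem: as C_3 = K_3,
   the first k vertices in lexicographic order span the most edges among
   k-sets. The lexicographic embedding, whose copies are the lines in one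
   direction, attains all these bounds at once. *)

(** * Base-3 digit sums and edge counts of lexicographic initial segments *)

Fixpoint digitsum3_fuel (fuel j : nat) : nat :=
  if fuel is fuel'.+1 then j %% 3 + digitsum3_fuel fuel' (j %/ 3) else 0.

Definition digitsum3 (j : nat) : nat := digitsum3_fuel j j.

Lemma digitsum3_fuelE (fuel j : nat) :
  j <= fuel -> digitsum3_fuel fuel j = digitsum3 j.
Proof.
rewrite /digitsum3; elim/ltn_ind: j fuel => -[|j] IH [|fuel] //= le_j.
  by elim: fuel {le_j} => //= fuel ->.
by congr (_ + _); rewrite !IH //; lia.
Qed.

Lemma digitsum3S (q r : nat) : r < 3 -> digitsum3 (3 * q + r) = digitsum3 q + r.
Proof.
move=> r3; rewrite -(@digitsum3_fuelE (3 * q + r).+1) //=.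
rewrite (_ : _ %% 3 = r); last by lia.
rewrite (_ : _ %/ 3 = q); last by lia.
by rewrite digitsum3_fuelE 1?addnC //; lia.
Qed.

(* The vertex number [j] in lexicographic order is adjacent to [digitsum3 j]
   earlier ones, so this is the number of edges spanned by the first [k]. *)
Definition lexedges (k : nat) : nat := \sum_(j < k) digitsum3 j.

Lemma lexedgesS (k : nat) : lexedges k.+1 = lexedges k + digitsum3 k.
Proof. by rewrite /lexedges big_ord_recr. Qed.

(** The first [3 * q] vertices form [q] full lines: three copies of the first [q] vertices one
    dimension lower, joined by [q] triangles. *)
Lemma lexedges_mul3 (q : nat) : lexedges (3 * q) = 3 * lexedges q + 3 * q.
Proof.
elim: q => [|q IH]; first by rewrite /lexedges big_ord0.
rewrite (_ : 3 * q.+1 = (3 * q + 2).+1); last by lia.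
rewrite lexedgesS digitsum3S // addn2 !lexedgesS -[(3 * q).+1]addn1 digitsum3S //.
by rewrite -[X in digitsum3 X]addn0 digitsum3S // IH; lia.
Qed.

Lemma lexedges_mul3D1 (q : nat) :
  lexedges (3 * q + 1) = 3 * lexedges q + 3 * q + digitsum3 q.
Proof.
rewrite addn1 lexedgesS lexedges_mul3.
by rewrite -[X in digitsum3 X]addn0 digitsum3S // addn0.
Qed.

Lemma lexedges_mul3D2 (q : nat) :
  lexedges (3 * q + 2) = 3 * lexedges q + 3 * q + 2 * digitsum3 q + 1.
Proof.
rewrite addn2 lexedgesS -[(3 * q).+1]addn1 lexedges_mul3D1 digitsum3S //.
by lia.
Qed.

(* The last base-3 digit splits an initial segment of length [k] into three
   initial segments whose lengths differ by at most one. *)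
Lemma lexedges_split (q r : nat) : r <= 6 ->
  let k j := q + (r + j) %/ 3 in
  lexedges (3 * q + r) = lexedges (k 0) + lexedges (k 1) + lexedges (k 2)
    + (2 * k 0 + k 1).
Proof.
move=> r6 /=.
have A p t c : 3 * p + (c * 3 + t) = 3 * (p + c) + t by lia.
move: r6; case: r => [|[|[|[|[|[|[|//]]]]]]] _ /=.
- by rewrite addn0 lexedges_mul3 !(addn0, add0n) /=; lia.
- by rewrite lexedges_mul3D1 !(addn0, addn1, lexedgesS); lia.
- by rewrite lexedges_mul3D2 !(addn0, addn1, lexedgesS); lia.
- by rewrite (A q 0 1) addn0 lexedges_mul3 !(addn0, addn1, lexedgesS); lia.
- by rewrite (A q 1 1) lexedges_mul3D1 !(addn0, addn1, addn2, lexedgesS); lia.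
- by rewrite (A q 2 1) lexedges_mul3D2 !(addn0, addn1, addn2, lexedgesS); lia.
- by rewrite (A q 0 2) addn0 lexedges_mul3 !(addn0, addn1, addn2, lexedgesS); lia.
Qed.

(* Induction on [a + b + c]: split each of the three segments by its last
   base-3 digit, placing the remainders cyclically so that the three column
   sums differ by at most one. *)
Lemma lexedges_merge (a b c : nat) :
  lexedges a + lexedges b + lexedges c + (minn a b + minn a c + minn b c)
  <= lexedges (a + b + c).
Proof.
have [N] := ubnP (a + b + c); elim: N a b c => // N IHN a b c ltN.
(* A total of 1 must be a base case, since one column would then carry the whole total; from 2 on
   every column sum is strictly smaller. *)
have [small|big] := leqP (a + b + c) 1.
  have e01 k : k <= 1 -> lexedges k = 0.
    by case: k => [|[|//]] _; rewrite /lexedges ?big_ord0 ?big_ord1.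
  by rewrite !e01; lia.
wlog ord : a b c ltN big / c <= b <= a.
  move=> H; have := H a b c; have := H a c b; have := H b a c.
  have := H b c a; have := H c a b; have := H c b a.
  rewrite (_ : a + c + b = a + b + c); last by lia.
  rewrite (_ : b + a + c = a + b + c); last by lia.
  rewrite (_ : b + c + a = a + b + c); last by lia.
  rewrite (_ : c + a + b = a + b + c); last by lia.
  rewrite (_ : c + b + a = a + b + c); last by lia.
  by case: (leqP a b) => ?; case: (leqP a c) => ?; case: (leqP b c) => ?; lia.
have -> : minn a b = b by lia.
have -> : minn a c = c by lia.
have -> : minn b c = c by lia.
have := divn_eq a 3; have := divn_eq b 3; have := divn_eq c 3.
have := ltn_pmod a (isT : 0 < 3); have := ltn_pmod b (isT : 0 < 3).
have := ltn_pmod c (isT : 0 < 3).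
move: (a %/ 3) (b %/ 3) (c %/ 3) (a %% 3) (b %% 3) (c %% 3).
move=> p q r i j k k3 j3 i3 ec eb ea.
have IH x y z : p + q + r + (x + y + z) < a + b + c ->
    lexedges (p + x) + lexedges (q + y) + lexedges (r + z)
     + (minn (p + x) (q + y) + minn (p + x) (r + z) + minn (q + y) (r + z))
    <= lexedges (p + q + r + (x + y + z)).
  move=> lt; rewrite (_ : p + q + r + _ = p + x + (q + y) + (r + z)).
    by apply: IHN; lia.
  by lia.
have -> : lexedges (a + b + c) = lexedges (3 * (p + q + r) + (i + j + k)).
  by congr lexedges; lia.
rewrite lexedges_split; last by lia.
rewrite ea eb ec ![_ * 3]mulnC !lexedges_split; try lia.
(* The [i] extra units of [a] fill columns from 0, the [j] of [b] the next ones cyclically, then the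
   [k] of [c]. Adding 3 and 6 keeps the subtractions from truncating. *)
pose x t : nat := t < i; pose y t : nat := (t + 3 - i) %% 3 < j.
pose z t : nat := (t + 6 - (i + j)) %% 3 < k.
have := IH (x 2) (y 2) (z 2); have := IH (x 1) (y 1) (z 1).
have := IH (x 0) (y 0) (z 0); rewrite {}/x {}/y {}/z.
case: i i3 ea => [|[|[|//]]] _ ea; case: j j3 eb => [|[|[|//]]] _ eb;
  case: k k3 ec => [|[|[|//]]] _ ec; rewrite /divn /modn /= ?addn0 ?add0n -?[1 + 1]/2; lia.
Qed.

Lemma lexedges_exp3 (k : nat) : lexedges (3 ^ k) = k * 3 ^ k.
Proof.
elim: k => [|k IH]; first by rewrite expn0 /lexedges big_ord1.
by rewrite expnS lexedges_mul3 IH; lia.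
Qed.

Lemma sum_lexedges_mul3 (q : nat) :
  \sum_(t < 3 * q) lexedges t
  = 9 * \sum_(t < q) lexedges t + 3 * lexedges q + 9 * \sum_(t < q) t + q.
Proof.
elim: q => [|q IH]; first by rewrite muln0 !big_ord0 /lexedges big_ord0.
have := lexedges_mul3D1 q; have := lexedges_mul3D2 q.
rewrite [3 * q + 1]addn1 [3 * q + 2]addn2 (_ : 3 * q.+1 = (3 * q).+3); last by lia.
rewrite !big_ord_recr /= IH lexedges_mul3 [lexedges q.+1]lexedgesS => D2 D1.
rewrite D1 D2; move: (\sum_(t < q) _) (\sum_(t < q) _) => E B; lia.
Qed.

Lemma sum_ord_id (m : nat) : 2 * \sum_(t < m) t = m * (m - 1).
Proof.
by elim: m => [|m IH]; rewrite ?big_ord0 // big_ord_recr /= mulnDr IH; nia.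
Qed.

(** This evaluates the total of the isoperimetric bounds over all cuts of the path; the term with
    factor 2 stands on the left to avoid the coefficient [3 * k - 2]. *)
Lemma sum_lexedges_exp3 (k : nat) :
  6 * \sum_(t < 3 ^ k) lexedges t + 2 * (3 ^ k * (3 ^ k - 1))
  = 3 * k * (3 ^ k * (3 ^ k - 1)).
Proof.
elim: k => [|k IH]; first by rewrite expn0 big_ord1 /lexedges big_ord0.
have := sum_lexedges_mul3 (3 ^ k); have := sum_ord_id (3 ^ k).
rewrite lexedges_exp3 expnS.
have : 0 < 3 ^ k by rewrite expn_gt0.
move: IH; move: (3 ^ k) (\sum_(t < _) lexedges t) (\sum_(t < _) t) (\sum_(t < _) _).
move=> m A B C IH m0; case: m m0 IH => // m _.
rewrite subSS subn0 (_ : 3 * m.+1 - 1 = 3 * m + 2); last by lia.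
nia.
Qed.

(** * Adjacency in $Q_n^3$ by its first coordinate, and edge isoperimetry *)

Definition fcons (n : nat) (a : 'I_3) (x : {ffun 'I_n -> 'I_3}) :
    {ffun 'I_n.+1 -> 'I_3} :=
  [ffun i => if unlift ord0 i is Some j then x j else a].

Definition ftail (n : nat) (x : {ffun 'I_n.+1 -> 'I_3}) : {ffun 'I_n -> 'I_3} :=
  [ffun i => x (lift ord0 i)].

Lemma fcons0 (n : nat) (a : 'I_3) (x : {ffun 'I_n -> 'I_3}) : fcons a x ord0 = a.
Proof. by rewrite ffunE unlift_none. Qed.

Lemma fconsS (n : nat) (a : 'I_3) (x : {ffun 'I_n -> 'I_3}) (i : 'I_n) :
  fcons a x (lift ord0 i) = x i.
Proof. by rewrite ffunE liftK. Qed.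

Lemma ftailK (n : nat) (x : {ffun 'I_n.+1 -> 'I_3}) : fcons (x ord0) (ftail x) = x.
Proof.
apply/ffunP => i; rewrite ffunE.
by case: unliftP => [j|] ->; rewrite ?ffunE.
Qed.

Lemma fconsK (n : nat) (a : 'I_3) (x : {ffun 'I_n -> 'I_3}) : ftail (fcons a x) = x.
Proof. by apply/ffunP => i; rewrite ffunE fconsS. Qed.

Lemma sum_fcons (n : nat) (F : {ffun 'I_n.+1 -> 'I_3} -> nat) :
  \sum_x F x = \sum_a \sum_x F (fcons a x).
Proof.
rewrite pair_bigA /=.
apply: (reindex (fun p : 'I_3 * {ffun 'I_n -> 'I_3} => fcons p.1 p.2)).
apply: onW_bij; exists (fun x : {ffun _} => (x ord0, ftail x)) => [[a x]|x] /=.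
  by rewrite fcons0 fconsK.
exact: ftailK.
Qed.

(* On three residues, differing and differing by one modulo 3 coincide. *)
Lemma Q3_adjP (n : nat) (x y : {ffun 'I_n -> 'I_3}) :
  reflect (exists2 j, x j != y j & forall i, i != j -> x i = y i) (Q3_adj x y).
Proof.
apply: (iffP existsP) => -[j].
  case/and3P=> xyj /forallP xy _; exists j => // i ij.
  by apply/eqP; move: (xy i); rewrite ij.
move=> xyj xy; exists j; rewrite xyj /=; apply/andP; split.
  by apply/forallP => i; apply/implyP => /xy ->.
move: xyj; case: (x j) (y j) => [a a3] [b b3]; rewrite -val_eqE /=.
by case: a a3 => [|[|[|//]]] _; case: b b3 => [|[|[|//]]].
Qed.

Lemma Q3_adj_fcons (n : nat) (a b : 'I_3) (x y : {ffun 'I_n -> 'I_3}) :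
  Q3_adj (fcons a x) (fcons b y)
  = (a == b) && Q3_adj x y || (a != b) && (x == y).
Proof.
apply/Q3_adjP/orP => [[j]|[/andP[/eqP <- /Q3_adjP[j xyj xy]]|/andP[ab /eqP <-]]].
- case: (unliftP ord0 j) => [k|] ->; rewrite ?fcons0 ?fconsS => neq eqs.
    left; have := eqs _ (neq_lift ord0 k); rewrite !fcons0 => <-; rewrite eqxx.
    apply/Q3_adjP; exists k => // i ik; rewrite -(fconsS a x) -(fconsS b y).
    by apply: eqs; rewrite (inj_eq lift_inj).
  right; rewrite neq; apply/eqP/ffunP => i; rewrite -(fconsS a x) -(fconsS b y).
  by apply: eqs; rewrite eq_sym neq_lift.
- exists (lift ord0 j); first by rewrite !fconsS.
  move=> i; case: (unliftP ord0 i) => [k|] ->; rewrite ?fcons0 ?fconsS //.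
  by rewrite (inj_eq lift_inj) => /xy.
exists ord0; rewrite ?fcons0 // => i.
by case: (unliftP ord0 i) => [k|] ->; rewrite ?eqxx // !fconsS.
Qed.

Lemma Q3_adj0 (x y : {ffun 'I_0 -> 'I_3}) : Q3_adj x y = false.
Proof. by apply/existsP => -[[]]. Qed.

Lemma sum_ord3 (F : 'I_3 -> nat) :
  \sum_a F a = F (inord 0) + F (inord 1) + F (inord 2).
Proof.
rewrite !big_ord_recr big_ord0 /= add0n.
by congr (F _ + F _ + F _); apply: val_inj; rewrite /= inordK.
Qed.

(** Pairs are ordered, so a symmetric [F] is counted twice on each edge. *)
Definition adjsum (n : nat) (F : {ffun 'I_n -> 'I_3} -> {ffun 'I_n -> 'I_3} -> nat) :=
  \sum_x \sum_y Q3_adj x y * F x y.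

Lemma adjsum0 F : @adjsum 0 F = 0.
Proof. by rewrite /adjsum big1 // => x _; rewrite big1 // => y _; rewrite Q3_adj0. Qed.

Lemma adjsum_fcons (n : nat) F :
  @adjsum n.+1 F = \sum_a adjsum (fun x y => F (fcons a x) (fcons a y))
    + \sum_a \sum_(b | b != a) \sum_x F (fcons a x) (fcons b x).
Proof.
rewrite /adjsum sum_fcons -big_split; apply: eq_bigr => a _ /=.
rewrite [X in _ + X]exchange_big -big_split; apply: eq_bigr => x _ /=.
rewrite sum_fcons (bigD1 a) //=; congr (_ + _).
  by apply: eq_bigr => y _; rewrite Q3_adj_fcons eqxx orbF.
apply: eq_bigr => b ba; rewrite (bigD1 x) //= Q3_adj_fcons eqxx eq_sym ba orbT mul1n.
rewrite big1 ?addn0 // => y yx.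
by rewrite Q3_adj_fcons [a == b]eq_sym (negPf ba) /= [x == y]eq_sym (negPf yx).
Qed.

Lemma Q3_degree (n : nat) (x : {ffun 'I_n -> 'I_3}) : \sum_y Q3_adj x y = 2 * n.
Proof.
elim: n x => [|n IH] x; first by rewrite big1 // => y _; rewrite Q3_adj0.
rewrite -(ftailK x) sum_fcons (bigD1 (x ord0)) //=.
under eq_bigr do rewrite Q3_adj_fcons eqxx orbF.
rewrite IH; under eq_bigr => b ba.
  rewrite (bigD1 (ftail x)) //= Q3_adj_fcons eqxx eq_sym ba orbT big1.
    over.
  move=> y yx.
  by rewrite Q3_adj_fcons [_ == b]eq_sym (negPf ba) /= [_ == y]eq_sym (negPf yx).
rewrite sum_nat_const (_ : #|_| = 2); first by lia.
by rewrite (eq_card (B := predC1 (x ord0))) // cardC1 card_ord.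
Qed.

Lemma adjsum_sym (n : nat) F : @adjsum n (fun x y => F y x) = adjsum F.
Proof.
rewrite /adjsum exchange_big; apply: eq_bigr => x _; apply: eq_bigr => y _.
by rewrite Q3_adj_sym.
Qed.

Lemma adjsumD (n : nat) F G : @adjsum n (fun x y => F x y + G x y) = adjsum F + adjsum G.
Proof.
rewrite /adjsum -big_split; apply: eq_bigr => x _; rewrite -big_split.
by apply: eq_bigr => y _; rewrite mulnDr.
Qed.

Lemma eq_adjsum (n : nat) F G :
  (forall x y, Q3_adj x y -> F x y = G x y) -> @adjsum n F = adjsum G.
Proof.
move=> eqFG; apply: eq_bigr => x _; apply: eq_bigr => y _.
by case: (boolP (Q3_adj x y)) => [/eqFG ->|].

Qed.

Lemma adjsum_left (n : nat) g : @adjsum n (fun x _ => g x) = 2 * n * \sum_x g x.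
Proof.
rewrite big_distrr; apply: eq_bigr => x _.
by rewrite -big_distrl Q3_degree.
Qed.

(** Lindsey's bound, by induction on the dimension: the first coordinate cuts the set into three
    layers, and the edges between two layers form a matching, hence number at most the smaller
    layer. [lexedges_merge] is exactly the resulting numerical inequality. *)
Lemma Q3_edges_le (n : nat) (P : pred {ffun 'I_n -> 'I_3}) :
  adjsum (fun x y => P x && P y : nat) <= 2 * lexedges (\sum_x P x).
Proof.
elim: n P => [|n IH] P; first by rewrite adjsum0.
pose p a : nat := \sum_x P (fcons a x).
have -> : \sum_x P x = \sum_a p a by apply: sum_fcons.
rewrite adjsum_fcons.
have meet a b : \sum_x (P (fcons a x) && P (fcons b x) : nat) <= minn (p a) (p b).
  rewrite leq_min; apply/andP.
  by split; apply: leq_sum => x _; case: (P _) => //; case: (P _).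
set E := (X in X + _); have leE : E <= \sum_a 2 * lexedges (p a).
  by apply: leq_sum => a _; apply: IH.
apply: (@leq_trans (\sum_a 2 * lexedges (p a) + \sum_a \sum_(b | b != a) minn (p a) (p b))).
  by apply: leq_add => //; apply: leq_sum => a _; apply: leq_sum => b _; apply: meet.
under [X in _ + X]eq_bigr do rewrite big_mkcond sum_ord3 /=.
rewrite !sum_ord3 -!val_eqE /= !inordK //= !(addn0, add0n).
move: (p _) (p _) (p _) => u v w.
rewrite [minn v u]minnC [minn w u]minnC [minn w v]minnC.
by have := lexedges_merge w v u; lia.
Qed.

(** * Distances in the firecracker graph *)

Definition ndist (a b : nat) : nat := (a - b) + (b - a).

(* Distance from vertex [a] of a copy of the star to its leaf on the path. *)
Definition height (a : 'I_3) : nat :=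
  match val a with 0 => 1 | 1 => 0 | _ => 2 end.

(** A 3-vertex star is itself a path with heights 0, 1, 2 along it, whence the first branch. *)
Definition fdist (m : nat) (x y : firecracker m 3) : nat :=
  if x.1 == y.1 then ndist (height x.2) (height y.2)
  else ndist x.1 y.1 + height x.2 + height y.2.

Lemma fdistC (m : nat) (x y : firecracker m 3) : fdist x y = fdist y x.
Proof. by rewrite /fdist [y.1 == _]eq_sym /ndist; case: eqP => _; lia. Qed.

Lemma fdist_eq0 (m : nat) (x y : firecracker m 3) : fdist x y = 0 -> x = y.
Proof.
case: x y => [[i im] [a a3]] [[j jm] [b b3]]; rewrite /fdist -val_eqE /ndist /=.
move=> H; have ij : i = j by move: H; case: eqP => //; lia.
have ab : a = b; last by congr (_, _); apply: val_inj.
move: H; rewrite ij eqxx /height /=.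
by case: a a3 => [|[|[|//]]] _; case: b b3 => [|[|[|//]]].
Qed.

Lemma fdist_adj (m : nat) (x y z : firecracker m 3) :
  adj x y -> fdist x z <= (fdist y z).+1.
Proof.
case: x y z => [[i im] [a a3]] [[j jm] [b b3]] [[k km] [c c3]].
rewrite /= /firecracker_adj /fdist -!val_eqE /height /ndist /= => {im jm km}.
case: (i =P j) => [->|ij] /=; case: (j =P k) => [->|jk] /=;
  try case: (i =P k) => [->|ik] /=;
case: a a3 => [|[|[|//]]] _; case: b b3 => [|[|[|//]]] _ //=;
case: c c3 => [|[|[|//]]] _ //=; lia.
Qed.

Local Ltac simpl_fdist :=
  rewrite /= /firecracker_adj /fdist -!val_eqE /height /ndist /=;
  repeat case: eqP => //=; lia.

Lemma fdist_step (m : nat) (x y : firecracker m 3) : 0 < fdist x y ->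
  exists2 x' : firecracker m 3, adj x x' & (fdist x' y).+1 = fdist x y.
Proof.
case: x y => [[i im] [a a3]] [[j jm] [b b3]].
have move_to k (km : k < m) c (c3 : c < 3) :
    let x' : firecracker m 3 := (Ordinal km, Ordinal c3) in
    let x : firecracker m 3 := (Ordinal im, Ordinal a3) in
    let y : firecracker m 3 := (Ordinal jm, Ordinal b3) in
    adj x x' && ((fdist x' y).+1 == fdist x y) ->
    exists2 x' : firecracker m 3, adj x x' & (fdist x' y).+1 = fdist x y.
  by move=> x' x y /andP[xx' /eqP]; exists x'.
case: (ltngtP i j) => ij.
- case: a a3 move_to => [|[|[|//]]] a3 move_to _.
  + by apply: (move_to i im 1 isT); simpl_fdist.
  + have im' : i.+1 < m by lia.
    by apply: (move_to i.+1 im' 1 isT); simpl_fdist.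
  + by apply: (move_to i im 0 isT); simpl_fdist.
- case: a a3 move_to => [|[|[|//]]] a3 move_to _.
  + by apply: (move_to i im 1 isT); simpl_fdist.
  + have im' : i.-1 < m by lia.
    by apply: (move_to i.-1 im' 1 isT); simpl_fdist.
  + by apply: (move_to i im 0 isT); simpl_fdist.
move: jm move_to; rewrite -ij => jm.
case: a a3 => [|[|[|//]]] a3; case: b b3 => [|[|[|//]]] b3 move_to;
  rewrite {1}/fdist -val_eqE /= eqxx // => _.
- by apply: (move_to i im 1 isT); simpl_fdist.
- by apply: (move_to i im 2 isT); simpl_fdist.
- by apply: (move_to i im 0 isT); simpl_fdist.
- by apply: (move_to i im 0 isT); simpl_fdist.
- by apply: (move_to i im 0 isT); simpl_fdist.
- by apply: (move_to i im 0 isT); simpl_fdist.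
Qed.

(** Descending by [fdist_step] produces a walk of length [fdist x y]; by [fdist_adj] each edge
    lowers [fdist] by at most one, so no walk is shorter. *)
Lemma gdist_firecracker (m : nat) (x y : firecracker m 3) : gdist x y = fdist x y.
Proof.
have [/has_walkP[p [szp pp lp]] min] :=
  gdistP (@firecracker_connected m 3 x y isT).
apply/eqP; rewrite eqn_leq; apply/andP; split.
  apply: min; apply/has_walkP; move: (erefl (fdist x y)).
  move: {2}(fdist x y) => d; elim: d x {p szp pp lp} => [|d IH] x dxy.
    by exists [::]; rewrite dxy /= (fdist_eq0 dxy).
  have [|x' xx' dx'] := @fdist_step m x y; first by rewrite dxy.
  have [|p [sp pp lp]] := IH x'; first by lia.
  exists (x' :: p); split=> //=; first by rewrite sp.
  by apply/andP.
rewrite -szp -lp; elim: p x pp {szp lp min} => [|z p IH] x /=.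
  by move=> _; rewrite /fdist eqxx /ndist subnn.
case/andP=> xz /IH le; by apply: (leq_trans (@fdist_adj m x z (last z p) xz)).
Qed.

(** * Splitting the wirelength into path, height and twin contributions, and bounding them *)

Lemma WLf_double (G T : sgraph) (f : {ffun G -> T}) (d : T -> T -> nat) :
  (forall x y, gdist x y = d x y) -> (forall x y, d x y = d y x) ->
  2 * WLf f = \sum_u \sum_v adj u v * d (f u) (f v).
Proof.
move=> dE dC; rewrite mul2n -addnn {2}/WLf.
(* One of the two copies is transposed and supplies the edges in the opposite orientation. *)
rewrite (exchange_big_dep predT) //= /WLf -big_split; apply: eq_bigr => u _ /=.
rewrite [RHS](bigID (fun v => enum_rank u < enum_rank v)) /=; congr (_ + _).
  rewrite big_mkcond [RHS]big_mkcond; apply: eq_bigr => v _.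
  by rewrite dE; case: adj; case: ltnP; rewrite ?mul1n.
rewrite big_mkcond [RHS]big_mkcond; apply: eq_bigr => v _.
rewrite -leqNgt dE dC adj_sym.
have [->|vu] := eqVneq v u; first by rewrite adj_irrefl if_same.
have rank_ne : enum_rank v != enum_rank u :> nat.
  by apply: contraNneq vu => /ord_inj/enum_rank_inj ->.
by rewrite ltn_neqAle rank_ne; case: adj; case: leqP; rewrite ?mul1n.
Qed.

(* The only pairs whose distance is not the distance of their copies along the
   path plus the two heights. *)
Definition twin (m : nat) (x y : firecracker m 3) : bool :=
  (x.1 == y.1) && ([&& val x.2 == 0 & val y.2 == 2] || [&& val x.2 == 2 & val y.2 == 0]).

Lemma fdist_twin (m : nat) (x y : firecracker m 3) : x != y ->
  fdist x y + 2 * twin x y = ndist x.1 y.1 + (height x.2 + height y.2).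
Proof.
case: x y => [i [a a3]] [j [b b3]]; rewrite /fdist /twin /=.
have [->|_] := eqVneq i j; last by rewrite addn0 addnA.
rewrite xpair_eqE eqxx -val_eqE /= /ndist subnn /height /=.
by case: a a3 => [|[|[|//]]] _; case: b b3 => [|[|[|//]]].
Qed.

Lemma sum_firecracker (m : nat) (F : firecracker m 3 -> nat) :
  \sum_x F x = \sum_(i < m) (F (i, inord 0) + F (i, inord 1) + F (i, inord 2)).
Proof.
transitivity (\sum_(i < m) \sum_(a < 3) F (i, a)).
  by rewrite pair_bigA; apply: eq_bigr => -[i a].
by apply: eq_bigr => i _; rewrite sum_ord3.
Qed.

Lemma sum_twin (m : nat) : \sum_(x : firecracker m 3) \sum_y twin x y = 2 * m.
Proof.
rewrite sum_firecracker mulnC -[m in m * 2]card_ord -sum_nat_const.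
apply: eq_bigr => i _; rewrite !sum_firecracker -!big_split /= (bigD1 i) //=.
rewrite /twin /= !inordK // !eqxx /= big1 // => j ji.
by rewrite eq_sym (negPf ji).
Qed.

Lemma sum_height (m : nat) : \sum_(x : firecracker m 3) height x.2 = 3 * m.
Proof.
rewrite sum_firecracker mulnC -[m in m * 3]card_ord -sum_nat_const.
by apply: eq_bigr => i _; rewrite /height /= !inordK.
Qed.

Lemma sum_bij (G T : finType) (f : G -> T) (F : T -> nat) :
  bijective f -> \sum_x F (f x) = \sum_y F y.
Proof. by move=> fb; rewrite [RHS](reindex f) //; apply: onW_bij. Qed.

(** The distance along a path is the number of its edges separating the two points; the threshold
    [t] stands for the edge from [t - 1] to [t], and [t = 0] separates nothing. *)
Lemma ndist_sum_cuts (m a b : nat) : a < m -> b < m ->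
  ndist a b = \sum_(t < m) ((a < t) && ~~ (b < t)) + \sum_(t < m) ((b < t) && ~~ (a < t)).
Proof.
have cut x y : y < m -> \sum_(t < m) ((x < t) && ~~ (y < t) : nat) = y - x.
  elim: m y => // k IH y yk; rewrite big_ord_recr /=.
  have [{}yk|ky] := ltnP y k; first by rewrite IH // andbF addn0.
  have {ky yk} -> : y = k by lia.
  case: k IH => [|k] IH; first by rewrite big_ord0 andbT ltn0.
  rewrite (eq_bigr (fun t : 'I_k.+1 => (x < t) && ~~ (k < t) : nat)).
    by rewrite IH // andbT; lia.
  by move=> [t /= tk] _; congr (nat_of_bool (_ && _)); lia.
by move=> am bm; rewrite !cut // /ndist addnC.
Qed.

Lemma WLf_Q3_firecracker (k : nat) (f : {ffun Q3 k.+1 -> firecracker (3 ^ k) 3}) :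
  bijective f ->
  2 * WLf f + 2 * adjsum (fun u v => twin (f u) (f v) : nat)
  = adjsum (fun u v => ndist (f u).1 (f v).1) + 12 * k.+1 * 3 ^ k.
Proof.
move=> f_bij; rewrite (WLf_double f (@gdist_firecracker _) (@fdistC _)).
have adjE : \sum_u \sum_v adj u v * fdist (f u) (f v) = adjsum (fun u v => fdist (f u) (f v)).
  by [].
rewrite adjE mul2n -addnn -!adjsumD.
(* The heights total [3 * 3 ^ k]; each is counted with the degree [2 * k.+1], once for each end of
   an ordered pair. *)
rewrite (_ : 12 * _ * _ = adjsum (fun u v => height (f u).2 + height (f v).2)).
  rewrite -adjsumD; apply: eq_adjsum => u v uv.
  rewrite -fdist_twin ?mul2n ?addnn //.
  rewrite (inj_eq (bij_inj f_bij)); apply: contraTneq uv => ->.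
  by rewrite Q3_adj_irrefl.
rewrite adjsumD (adjsum_sym (fun u v => height (f u).2)).
rewrite (adjsum_left (fun u => height (f u).2)).
rewrite (sum_bij (fun x => height x.2) f_bij) sum_height; lia.
Qed.

(** Dropping adjacency leaves all twin pairs of the tree, two ordered ones per copy. *)
Lemma twin_pairs_le (k : nat) (f : {ffun Q3 k.+1 -> firecracker (3 ^ k) 3}) :
  bijective f -> adjsum (fun u v => twin (f u) (f v) : nat) <= 2 * 3 ^ k.
Proof.
move=> f_bij; rewrite -sum_twin -(sum_bij _ f_bij); apply: leq_sum => u _.
rewrite -(sum_bij _ f_bij); apply: leq_sum => v _.
by case: Q3_adj; rewrite ?mul1n.
Qed.

Lemma card_initial (k : nat) (f : {ffun Q3 k.+1 -> firecracker (3 ^ k) 3})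
    (t : nat) :
  bijective f -> t <= 3 ^ k -> \sum_u ((f u).1 < t) = 3 * t.
Proof.
move=> f_bij tm; rewrite (sum_bij (fun x : firecracker _ _ => x.1 < t : nat) f_bij).
have cnt m : \sum_(i < m) (i < t) = minn t m.
  elim: m => [|m IH]; first by rewrite big_ord0 minn0.
  by rewrite big_ord_recr /= IH; lia.
rewrite sum_firecracker (eq_bigr (fun i : 'I__ => 3 * (i < t))) => [|i _] /=.
  by rewrite -big_distrr /= cnt; lia.
by lia.
Qed.

Lemma path_part_ge (k : nat) (f : {ffun Q3 k.+1 -> firecracker (3 ^ k) 3}) :
  bijective f ->
  4 * (3 ^ k * (3 ^ k - 1)) <= adjsum (fun u v => ndist (f u).1 (f v).1).
Proof.
move=> f_bij; pose pos u : nat := (f u).1.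
pose B t := adjsum (fun u v => (pos u < t) && ~~ (pos v < t) : nat).
have -> : adjsum (fun u v => ndist (f u).1 (f v).1) = 2 * \sum_(t < 3 ^ k) B t.
  rewrite (eq_adjsum (G := fun u v => \sum_(t < 3 ^ k) ((pos u < t) && ~~ (pos v < t))
     + \sum_(t < 3 ^ k) ((pos v < t) && ~~ (pos u < t)))); last first.
    by move=> u v _; apply: ndist_sum_cuts; apply: ltn_ord.
  rewrite adjsumD (adjsum_sym (fun u v => \sum_(t < 3 ^ k) ((pos u < t) && ~~ (pos v < t)))).
  rewrite addnn -mul2n; congr (2 * _); rewrite /B /adjsum [RHS]exchange_big /=.
  apply: eq_bigr => u _; rewrite [RHS]exchange_big /=; apply: eq_bigr => v _.
  by rewrite big_distrr.
(* The [3 * t] vertices before the cut have total degree [6 * k.+1 * t], and the edges inside them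
   absorb at most [2 * lexedges (3 * t)], that is [6 * lexedges t + 6 * t]. *)
have B_ge (t : 'I_(3 ^ k)) : 6 * k * t <= B t + 6 * lexedges t.
  have tm := ltnW (ltn_ord t).
  have := Q3_edges_le (fun u => pos u < t); rewrite (card_initial f_bij tm).
  set E := adjsum _ => leE.
  have : B t + E = adjsum (fun u v => pos u < t : nat).
    rewrite -adjsumD; apply: eq_adjsum => u v _.
    by case: (_ < t); case: (_ < t).
  rewrite (adjsum_left (fun u => pos u < t : nat)) (card_initial f_bij tm).
  by rewrite lexedges_mul3 in leE; lia.
have := @leq_sum _ (index_enum _) predT _ _ (fun t _ => B_ge t).
rewrite big_split -!big_distrr /=.
have := sum_lexedges_exp3 k; have := sum_ord_id (3 ^ k).
move: (\sum_(t < _) t) (\sum_(t < _) lexedges t) (\sum_(t < _) B t) => X Y Z.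
move: (3 ^ k * _) => W.
nia.
Qed.

(** * The lexicographic embedding and its optimality *)

Fixpoint lexcode (n : nat) : {ffun 'I_n -> 'I_3} -> nat :=
  if n is n'.+1 then fun x => x ord0 + 3 * lexcode (ftail x) else fun=> 0.

Lemma lexcode_lt (n : nat) (x : {ffun 'I_n -> 'I_3}) : lexcode x < 3 ^ n.
Proof.
elim: n x => [|n IH] x //=; rewrite expnS.
by have := IH (ftail x); have := ltn_ord (x ord0); lia.
Qed.

Lemma lexcode_inj (n : nat) : injective (@lexcode n).
Proof.
elim: n => [|n IH] x y /=; first by move=> _; apply/ffunP => -[].
have := ltn_ord (x ord0); have := ltn_ord (y ord0) => y3 x3 e.
rewrite -(ftailK x) -(ftailK y); congr fcons; last by apply: IH; lia.
by apply: ord_inj; lia.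
Qed.

(** Coordinate 0 is the least significant digit: edges inside a layer get three times their length
    in dimension [n], while those between layers have lengths 1, 2, 1, with sum 8 over ordered pairs
    of layers. *)
Lemma adjsum_lexcode (n : nat) :
  3 * adjsum (fun x y => ndist (@lexcode n x) (lexcode y)) = 4 * (3 ^ n * (3 ^ n - 1)).
Proof.
elim: n => [|n IH]; first by rewrite adjsum0.
have cardQ : #|{ffun 'I_n -> 'I_3}| = 3 ^ n by rewrite card_ffun !card_ord.
rewrite adjsum_fcons.
rewrite (eq_bigr (fun=> 3 * adjsum (fun x y => ndist (@lexcode n x) (lexcode y)))); last first.
  move=> a _; rewrite /adjsum big_distrr; apply: eq_bigr => x _.
  rewrite big_distrr; apply: eq_bigr => y _ /=.
  by rewrite !fcons0 !fconsK /ndist; case: Q3_adj; lia.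
rewrite [X in _ + X](eq_bigr (fun a : 'I_3 => \sum_(b | b != a) 3 ^ n * ndist a b)); last first.
  move=> a _; apply: eq_bigr => b _; rewrite -cardQ -sum_nat_const; apply: eq_big => // x _ /=.
  by rewrite !fcons0 !fconsK /ndist; lia.
rewrite sum_nat_const card_ord IH.
under [X in _ + X]eq_bigr do rewrite big_mkcond sum_ord3 /=.
rewrite !sum_ord3 -!val_eqE /= !inordK //= /ndist expnS.
by have : 0 < 3 ^ n; rewrite ?expn_gt0 //; nia.
Qed.

(** Each copy of the star is the image of a line in direction 0, so its twins come from adjacent
    vertices. *)
Definition lexmap (k : nat) : {ffun Q3 k.+1 -> firecracker (3 ^ k) 3} :=
  [ffun x : Q3 k.+1 => (Ordinal (lexcode_lt (ftail x)), x ord0)].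

Lemma lexmap_bij (k : nat) : bijective (lexmap k).
Proof.
apply: inj_card_bij => [x y|].
  rewrite !ffunE => -[/lexcode_inj xy0 xy].
  by rewrite -(ftailK x) -(ftailK y) xy xy0.
by rewrite card_prod card_ffun !card_ord expnSr.
Qed.

Lemma path_part_lexmap (k : nat) :
  adjsum (fun u v => ndist (lexmap k u).1 (lexmap k v).1) = 4 * (3 ^ k * (3 ^ k - 1)).
Proof.
(* Edges in direction 0 stay in one copy and add nothing; the rest form three equal layers, hence
   the factor 3 in [adjsum_lexcode]. *)
rewrite -adjsum_lexcode adjsum_fcons [X in _ + X]big1; last first.
  move=> a _; rewrite big1 // => b _; rewrite big1 // => x _.
  by rewrite !ffunE /= !fconsK /ndist subnn.
rewrite addn0 (eq_bigr (fun=> adjsum (fun x y => ndist (@lexcode k x) (lexcode y)))).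
  by rewrite sum_nat_const card_ord.
move=> a _; apply: eq_adjsum => x y _.
by rewrite !ffunE /= !fconsK.
Qed.

Lemma twin_pairs_lexmap (k : nat) :
  adjsum (fun u v => twin (lexmap k u) (lexmap k v) : nat) = 2 * 3 ^ k.
Proof.
rewrite -sum_twin -(sum_bij _ (lexmap_bij k)); apply: eq_bigr => u _.
rewrite -(sum_bij _ (lexmap_bij k)); apply: eq_bigr => v _.
case: (boolP (Q3_adj u v)); rewrite ?mul1n // mul0n => uv; apply/esym/eqP.
rewrite eqb0; apply: contra uv => /andP[]; rewrite !ffunE /= -val_eqE /=.
move=> /eqP/lexcode_inj tuv roles.
rewrite -(ftailK u) -(ftailK v) Q3_adj_fcons tuv eqxx andbT.
by apply/orP; right; apply: contraTneq roles => ->; case: (val _) => [|[|[]]].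
Qed.

Theorem theorem5p9 (n : nat) (hn : 1 <= n) :
  WL (Q3 n) (firecracker (3 ^ (n - 1)) 3)
  = 2 * 3 ^ (n - 1) * ((3 ^ (n - 1) - 1) + (2 * n - 1) + n).
Proof.
case: n hn => // k _; rewrite subSS subn0.
have [[f fb <-] min] := WLP (ex_intro _ _ (lexmap_bij k)).
(* A minimizer [f] has at least the path part of [lexmap k] and at most its twin part, so the
   wirelengths agree. *)
have := min _ (lexmap_bij k).
have := WLf_Q3_firecracker (lexmap_bij k).
have := WLf_Q3_firecracker fb; have := twin_pairs_le fb.
have := path_part_ge fb; rewrite path_part_lexmap twin_pairs_lexmap.
nia.
Qed.
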